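(* For each $0<p<1$ and each $p\le q\le 1$ there is a pointed $q$-metric space $(\mathcal M,\rho)$ and a subset $\mathcal N\subseteq\mathcal M$ containing the base point such that the inclusion map $\jmath\colon\mathcal N\to\mathcal M$ induces a non-isometric isomorphic embedding $L_\jmath\colon\mathcal F_p(\mathcal N)\to\mathcal F_p(\mathcal M)$ with $\|L_\jmath^{-1}\|\ge 2^{1/q}$, where $L_\jmath^{-1}$ is the inverse of $L_\jmath$ defined on the range $L_\jmath(\mathcal F_p(\mathcal N))$.
   Context: All vector spaces are real. For $0<p\le 1$, a $p$-metric on a set $\mathcal{M}$ is a symmetric map $\rho\colon\mathcal M\times\mathcal M\to[0,\infty)$ with $\rho(x,y)=0$ iff $x=y$ and $\rho(x,y)^p\le\rho(x,z)^p+\rho(z,y)^p$ for all $x,y,z$ (if $p\le q$, every $q$-metric is a $p$-metric). A pointed space has a distinguished point $0$. A $p$-norm on a vector space $Y$ is a map $\|\cdot\|_Y\colon Y\to[0,\infty)$, vanishing only at $0$, with $\|\alpha y\|_Y=|\alpha|\|y\|_Y$ and $\|y+z\|_Y^p\le\|y\|_Y^p+\|z\|_Y^p$. A map $f\colon\mathcal M\to Y$ is $1$-Lipschitz if $\|f(x)-f(y)\|_Y\le\rho(x,y)$ for all $x,y$. Let $(\mathcal M,\rho)$ be a pointed $p$-metric space, let $\mathbb R_0^{\mathcal M}$ be the space of all functions $f\colon\mathcal M\to\mathbb R$ with $f(0)=0$, let $\delta_{\mathcal M}(x)$ be the linear functional on $\mathbb R_0^{\mathcal M}$ given by $\langle\delta_{\mathcal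 M}(x),f\rangle=f(x)$, and let $\mathcal P(\mathcal M)$ be the linear span of $\{\delta_{\mathcal M}(x)\colon x\in\mathcal M\}$. For $\mu=\sum_{j=1}^N a_j\delta_{\mathcal M}(x_j)$ put $$\|\mu\|_{\mathcal F_p(\mathcal M)}=\sup\Big\|\sum_{j=1}^N a_jf(x_j)\Big\|_Y,$$ the supremum being over all $p$-normed spaces $Y$ and all $1$-Lipschitz maps $f\colon\mathcal M\to Y$ with $f(0)=0$. This is a $p$-norm on $\mathcal P(\mathcal M)$, and the Lipschitz free $p$-space $\mathcal F_p(\mathcal M)$ is the completion of $\mathcal P(\mathcal M)$ with respect to it. If $\mathcal N\subseteq\mathcal M$ contains $0$ and carries the restricted $p$-metric, with inclusion $\jmath$, then $L_\jmath\colon\mathcal F_p(\mathcal N)\to\mathcal F_p(\mathcal M)$ is the unique bounded linear operator with $L_\jmath(\delta_{\mathcal N}(x))=\delta_{\mathcal M}(x)$ for all $x\in\mathcal N$. An isomorphic embedding is a linear map which is a linear homeomorphism onto its range. *)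

(* Defs.v *)
From HB Require Import structures.
From mathcomp Require Import all_boot all_order all_algebra.
From mathcomp Require Import all_classical all_reals all_analysis.

Set Implicit Arguments.
Unset Strict Implicit.
Unset Printing Implicit Defensive.

Import Order.TTheory GRing.Theory Num.Theory.
Import numFieldNormedType.Exports.

Local Open Scope classical_set_scope.
Local Open Scope ring_scope.
Local Open Scope quotient_scope.

Definition is_pseminorm (R : realType) (p : R) (Y : lmodType R) (nrm : Y -> R) :=
  [/\ forall y, 0 <= nrm y,
      forall a y, nrm (a *: y) = `|a| * nrm y
    & forall y z, nrm (y + z) `^ p <= nrm y `^ p + nrm z `^ p].

Definition is_pnorm (R : realType) (p : R) (Y : lmodType R) (nrm : Y -> R) :=
  is_pseminorm p nrm /\ forall y, nrm y = 0 -> y = 0.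

Record pNormed (R : realType) (p : R) := PNormed {
  pn_sort :> lmodType R;
  pnorm : pn_sort -> R;
  pnormP : is_pnorm p pnorm }.

Definition is_pmetric (R : realType) (p : R) (M : Type) (rho : M -> M -> R) :=
  [/\ forall x y, 0 <= rho x y,
      forall x y, rho x y = 0 <-> x = y,
      forall x y, rho x y = rho y x
    & forall x y z, rho x y `^ p <= rho x z `^ p + rho z y `^ p].

Record pointedPMetric (R : realType) (p : R) := PointedPMetric {
  pm_sort :> Type;
  dist : pm_sort -> pm_sort -> R;
  base : pm_sort;
  distP : is_pmetric p dist }.

Arguments base {R p} _.

Section Restriction.
Variables (R : realType) (p : R) (M : pointedPMetric p) (N : set M).
Hypothesis N0 : N (base M).

Definition restr_dist (x y : N) : R := dist (val x) (val y).

Lemma restr_distP : is_pmetric p restr_dist.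
Proof.
have [d0 d1 d2 d3] := distP M.
split=> [x y|x y|x y|x y z]; rewrite /restr_dist ?d0 ?d3//.
by rewrite d1; split=> [/val_inj//|->].
Qed.

Definition restr : pointedPMetric p :=
  PointedPMetric (exist _ (base M) (mem_set N0) : N) restr_distP.

End Restriction.

Section PowerFacts.
Variables (R : realType) (p : R).
Hypothesis p0 : 0 < p.

Lemma powRK (a : R) : 0 <= a -> (a `^ p) `^ p^-1 = a.
Proof. by move=> a0; rewrite -powRrM divff ?gt_eqF// powRr1. Qed.

Lemma powRVK (a : R) : 0 <= a -> (a `^ p^-1) `^ p = a.
Proof. by move=> a0; rewrite -powRrM mulVf ?gt_eqF// powRr1. Qed.

Lemma powR_le (a b : R) : 0 <= a -> a <= b -> a `^ p <= b `^ p.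
Proof.
by move=> a0 ab; apply: ge0_ler_powR => //; [exact: ltW|exact: le_trans ab].
Qed.

Lemma powR_lt (a b : R) : 0 <= a -> a < b -> a `^ p < b `^ p.
Proof.
move=> a0 ab; apply: gt0_ltr_powR; rewrite ?nnegrE//.
exact: le_trans a0 (ltW ab).
Qed.

Lemma powR_leV (a b : R) : 0 <= a -> 0 <= b -> a `^ p <= b `^ p -> a <= b.
Proof.
by move=> a0 b0; rewrite !leNgt; apply: contra => ba; exact: powR_lt.
Qed.

Lemma powR_ltV (a b : R) : 0 <= a -> 0 <= b -> a `^ p < b `^ p -> a < b.
Proof.
by move=> a0 b0; rewrite !ltNge; apply: contra => ba; exact: powR_le.
Qed.

End PowerFacts.

Lemma cvg_powR (R : realType) (r : R) (v : nat -> R) (l : R) : 0 < r ->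
  (forall n, 0 <= v n) -> v @ \oo --> l -> v n `^ r @[n --> \oo] --> l `^ r.
Proof.
move=> r0 v0 vl.
have l0 : 0 <= l.
  rewrite -(cvg_lim _ vl)//; apply: limr_ge; first by apply/cvg_ex; exists l.
  by apply: nearW.
have rV0 : 0 < r^-1 by rewrite invr_gt0.
apply/cvgrPdist_lt => e e0.
have U : l < (l `^ r + e) `^ r^-1.
  rewrite -{1}(powRK r0 l0); apply: powR_lt => //; first exact: powR_ge0.
  by rewrite ltrDl.
have H1 : \forall n \near \oo, v n < (l `^ r + e) `^ r^-1.
  exact: cvgr_lt vl _ U.
have H2 : \forall n \near \oo, l `^ r - e < v n `^ r.
  have [Le|Le] := ltP (l `^ r - e) 0.
    by apply: nearW => n; apply: lt_le_trans Le (powR_ge0 _ _).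
  have B : (l `^ r - e) `^ r^-1 < l.
    rewrite -{2}(powRK r0 l0); apply: powR_lt => //.
    by rewrite gtrBl.
  have : \forall n \near \oo, (l `^ r - e) `^ r^-1 < v n by exact: cvgr_gt vl _ B.
  apply: filterS => n Bn.
  by rewrite -[ltLHS](powRVK r0)//; apply: powR_lt => //; exact: powR_ge0.
near=> n.
rewrite distrC ltr_distl; apply/andP; split; first by near: n.
rewrite -[ltRHS](powRVK r0); last by rewrite addr_ge0 ?powR_ge0 ?ltW.
by apply: powR_lt => //; near: n.
Unshelve. all: by end_near.
Qed.

(** Cauchy sequences modulo null sequences.  Only the seminorm axioms are
    needed; to_completion_norm, to_completion_dense and completion_complete
    below say that this is the completion. *)
Section Completion.
Variables (R : realType) (p : R).
Hypothesis p0 : 0 < p.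
Variables (Y : lmodType R) (nrm : Y -> R).
Hypothesis nrmP : is_pseminorm p nrm.

Let nrm_ge0 y : 0 <= nrm y. Proof. by case: nrmP. Qed.
Let nrmZ a y : nrm (a *: y) = `|a| * nrm y. Proof. by case: nrmP. Qed.
Let nrmD y z : nrm (y + z) `^ p <= nrm y `^ p + nrm z `^ p.
Proof. by case: nrmP. Qed.
Let nrm0 : nrm 0 = 0.
Proof. by rewrite -(scale0r (0 : Y)) nrmZ normr0 mul0r. Qed.
Let nrmN y : nrm (- y) = nrm y.
Proof. by rewrite -scaleN1r nrmZ normrN normr1 mul1r. Qed.

Definition seq_cauchy (u : nat -> Y) := forall e, 0 < e ->
  exists n0, forall m n, (n0 <= m)%N -> (n0 <= n)%N -> nrm (u m - u n) < e.

Definition cauchy_pred : {pred nat -> Y} := fun u => `[< seq_cauchy u >].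

Lemma seminormD_lt e y z : 0 < e ->
  nrm y < (e `^ p / 2) `^ p^-1 -> nrm z < (e `^ p / 2) `^ p^-1 ->
  nrm (y + z) < e.
Proof.
move=> e0 hy hz; apply: (powR_ltV p0) => //; first exact: ltW.
have e2 : 0 <= e `^ p / 2 by rewrite divr_ge0 ?powR_ge0.
apply: (le_lt_trans (nrmD _ _)).
rewrite [ltRHS](splitr (e `^ p)) ltrD//;
  by rewrite -[ltRHS](powRVK p0)//; apply: powR_lt.
Qed.

Lemma cauchy_closed : submod_closed cauchy_pred.
Proof.
split.
  by apply/asboolP => e e0; exists 0%N => m n _ _; rewrite subrr nrm0.
move=> a u v /asboolP cu /asboolP cv; apply/asboolP => e e0.
set d := (e `^ p / 2) `^ p^-1.
have d0 : 0 < d by rewrite powR_gt0// divr_gt0// powR_gt0.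
have a0 : 0 < `|a| + 1 by rewrite ltr_pwDr.
have [n1 h1] := cu _ (divr_gt0 d0 a0); have [n2 h2] := cv _ d0.
exists (maxn n1 n2) => m n; rewrite !geq_max => /andP[m1 m2] /andP[n1' n2'].
have -> : (a *: u + v) m - (a *: u + v) n = a *: (u m - u n) + (v m - v n).
  by rewrite scalerBr opprD addrACA.
apply: seminormD_lt => //; last exact: h2.
rewrite nrmZ; apply: le_lt_trans (_ : (`|a| + 1) * nrm (u m - u n) < d).
  by rewrite ler_wpM2r// lerDl.
by rewrite mulrC -ltr_pdivlMr// h1.
Qed.

HB.instance Definition _ :=
  GRing.isSubmodClosed.Build R (nat -> Y) cauchy_pred cauchy_closed.

Record cauchySeq := CauchySeq {
  cauchy_val :> nat -> Y;
  cauchy_valP : cauchy_val \in cauchy_pred }.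

HB.instance Definition _ := [isSub for cauchy_val].
HB.instance Definition _ := [Choice of cauchySeq by <:].
HB.instance Definition _ := [SubChoice_isSubLmodule of cauchySeq by <:].

Definition null_pred : {pred cauchySeq} :=
  fun u => `[< nrm (u n) @[n --> \oo] --> 0 >].

Lemma null_predP (u : cauchySeq) :
  reflect (forall e, 0 < e -> \forall n \near \oo, nrm (u n) < e)
          (u \in null_pred).
Proof.
apply: (iffP (asboolP _)) => [h e e0|h].
  exact: (cvgr_lt _ h _ e0).
apply/cvgrPdist_lt => e /h; apply: filterS => n.
by rewrite sub0r normrN ger0_norm.
Qed.

Lemma null_scale a u : u \in null_pred -> a *: u \in null_pred.
Proof.
move=> /asboolP h; apply/asboolP.
have -> : (fun n => nrm ((a *: u : cauchySeq) n)) = (fun n => `|a| * nrm (u n)).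
  by apply/funext => n; rewrite -nrmZ; congr nrm; rewrite [cauchy_val _]/(val _) linearZ.
by rewrite -[X in _ --> X](mulr0 `|a|); apply: cvgMr.
Qed.

Lemma null_closed : zmod_closed null_pred.
Proof.
split; first by apply/null_predP => e e0; apply: nearW => n; rewrite nrm0.
move=> u v /null_predP hu /null_predP hv; apply/null_predP => e e0.
set d := (e `^ p / 2) `^ p^-1.
have d0 : 0 < d by rewrite powR_gt0// divr_gt0// powR_gt0.
apply: filterS2 (hu _ d0) (hv _ d0) => n un vn.
by apply: seminormD_lt => //; rewrite nrmN.
Qed.

HB.instance Definition _ :=
  GRing.isZmodClosed.Build cauchySeq null_pred null_closed.

Definition completion := Quotient.quot null_pred.

HB.instance Definition _ := EqQuotient.on completion.
HB.instance Definition _ := Choice.on completion.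
HB.instance Definition _ := GRing.Zmodule.on completion.

Definition completion_pi (u : cauchySeq) : completion := \pi u.

Lemma completion_reprK (x : completion) : completion_pi (repr x) = x.
Proof. exact: reprK. Qed.

Lemma completion_piP (u v : cauchySeq) :
  reflect (completion_pi u = completion_pi v) (u - v \in null_pred).
Proof. by rewrite Quotient.idealrBE; exact: eqP. Qed.

Lemma completion_piD (u v : cauchySeq) :
  completion_pi (u + v) = completion_pi u + completion_pi v.
Proof. exact: (raddfD \pi_(Quotient.quot null_pred)). Qed.

Definition completion_scale (a : R) (x : completion) : completion :=
  completion_pi (a *: repr x).

Lemma completion_piZ a u :
  completion_pi (a *: u) = completion_scale a (completion_pi u).
Proof.
apply/completion_piP; rewrite -scalerBr; apply: null_scale.
by apply/completion_piP; rewrite completion_reprK.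
Qed.

Lemma completion_scaleA a b x : completion_scale a (completion_scale b x) =
  completion_scale (a * b) x.
Proof. by rewrite -[x]completion_reprK -!completion_piZ scalerA. Qed.

Lemma completion_scale1 : left_id 1 completion_scale.
Proof.
by move=> x; rewrite -[x in LHS]completion_reprK -completion_piZ scale1r
  completion_reprK.
Qed.

Lemma completion_scaleDr : right_distributive completion_scale +%R.
Proof.
move=> a x y; rewrite -[x]completion_reprK -[y]completion_reprK.
by rewrite -completion_piD -!completion_piZ -completion_piD scalerDr.
Qed.

Lemma completion_scaleDl x :
  {morph (completion_scale^~ x) : a b / a + b >-> a + b}.
Proof.
move=> a b; rewrite -[x]completion_reprK -!completion_piZ -completion_piD.
by rewrite scalerDl.
Qed.

HB.instance Definition _ := GRing.Zmodule_isLmodule.Build R completion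
  completion_scaleA completion_scale1 completion_scaleDr completion_scaleDl.

Lemma completion_pi_linear : linear completion_pi.
Proof. by move=> a u v; rewrite completion_piD completion_piZ. Qed.

HB.instance Definition _ :=
  GRing.isLinear.Build R cauchySeq completion *:%R completion_pi
    completion_pi_linear.

Definition completion_norm (x : completion) : R :=
  lim (nrm (repr x n) @[n --> \oo]).

Lemma nrmB_le y z : `|nrm y `^ p - nrm z `^ p| <= nrm (y - z) `^ p.
Proof.
rewrite ler_norml; apply/andP; split.
  rewrite lerBrDr addrC lerBlDr; have := nrmD (z - y) y.
  by rewrite subrK -[z - y]opprB nrmN addrC.
by rewrite lerBlDr; have := nrmD (y - z) z; rewrite subrK.
Qed.

Lemma cauchy_norm_cvg (u : cauchySeq) : cvg (nrm (u n) @[n --> \oo]).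
Proof.
have /asboolP cu := cauchy_valP u.
have : cvg (nrm (u n) `^ p @[n --> \oo]).
  apply/cauchy_cvgP/cauchy_exP => e e0.
  have d0 : 0 < e `^ p^-1 by rewrite powR_gt0.
  have [n0 h] := cu _ d0.
  exists (nrm (u n0) `^ p); exists n0 => // m /= hm; rewrite /ball/=.
  apply: le_lt_trans (nrmB_le _ _) _.
  rewrite -[ltRHS](powRVK p0 (ltW e0)); apply: (powR_lt p0) => //.
  exact: h.
move=> /cvg_ex[l hl]; apply/cvg_ex; exists (l `^ p^-1).
have -> : (fun n => nrm (u n)) = (fun n => (nrm (u n) `^ p) `^ p^-1).
  by apply/funext => n; rewrite powRK.
by apply: cvg_powR hl; rewrite ?invr_gt0// => n; exact: powR_ge0.
Qed.

Lemma completion_normE (u : cauchySeq) :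
  nrm (u n) @[n --> \oo] --> completion_norm (completion_pi u).
Proof.
set w : cauchySeq := repr (completion_pi u).
have hw : nrm (w n) @[n --> \oo] --> completion_norm (completion_pi u).
  exact: cauchy_norm_cvg.
have /asboolP huw : u - w \in null_pred.
  by apply/completion_piP; rewrite completion_reprK.
have huwp := cvg_powR p0 (fun n => nrm_ge0 _) huw.
have hwp := cvg_powR p0 (fun n => nrm_ge0 _) hw.
have up : nrm (u n) `^ p @[n --> \oo] --> completion_norm (completion_pi u) `^ p.
  apply: (cvg_sub0 _ hwp); apply/norm_cvg0P.
  rewrite powR0 ?gt_eqF// in huwp.
  apply: (squeeze_cvgr _ (cvg_cst 0) huwp).
  by apply: nearW => n /=; rewrite normr_ge0/=; exact: nrmB_le.
have L0 : 0 <= completion_norm (completion_pi u).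
  by apply: (cvgr_to_ge hw); apply: nearW.
have -> : (fun n => nrm (u n)) = (fun n => (nrm (u n) `^ p) `^ p^-1).
  by apply/funext => n; rewrite powRK.
rewrite -(powRK p0 L0).
by apply: cvg_powR up; rewrite ?invr_gt0// => n; exact: powR_ge0.
Qed.

Lemma completion_normP : is_pnorm p completion_norm.
Proof.
have N0 x : 0 <= completion_norm x.
  rewrite -[x]completion_reprK; have h := @completion_normE (repr x).
  by apply: (cvgr_to_ge h); apply: nearW.
split; first split => //.
- move=> a x; rewrite -[x]completion_reprK -linearZ/=.
  apply: (cvg_unique _ (@completion_normE _)) => //=.
  have -> : (fun n => nrm ((a *: repr x : cauchySeq) n)) =
            (fun n => `|a| * nrm (repr x n)).
    by apply/funext => n; rewrite -nrmZ.
  by apply: cvgMr; exact: @completion_normE.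
- move=> x y; rewrite -[x]completion_reprK -[y]completion_reprK -linearD/=.
  have hp (u : cauchySeq) := cvg_powR p0 (fun n => nrm_ge0 _) (@completion_normE u).
  apply: (ler_cvg_to (hp _) (cvgD (hp _) (hp _))).
  by apply: nearW => n; exact: nrmD.
- move=> x x0; rewrite -[x]completion_reprK -(linear0 completion_pi).
  apply/completion_piP; rewrite subr0; apply/asboolP.
  have := @completion_normE (repr x); by rewrite completion_reprK x0.
Qed.

End Completion.

Section CompletionEmbedding.
Variables (R : realType) (p : R).
Hypothesis p0 : 0 < p.
Variables (Y : lmodType R) (nrm : Y -> R).
Hypothesis nrmP : is_pseminorm p nrm.

Lemma cst_cauchy (y : Y) : (fun=> y) \in cauchy_pred nrm.
Proof.
apply/asboolP => e e0; exists 0%N => m n _ _; rewrite subrr.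
by have [_ nrmZ _] := nrmP; rewrite -(scale0r y) nrmZ normr0 mul0r.
Qed.

Definition to_completion (y : Y) : completion p0 nrmP :=
  completion_pi p0 nrmP (CauchySeq (cst_cauchy y)).

Lemma to_completion_linear : linear to_completion.
Proof.
move=> a y z; rewrite /to_completion -linearP; congr completion_pi.
exact/val_inj.
Qed.

HB.instance Definition _ :=
  GRing.isLinear.Build R Y (completion p0 nrmP) *:%R to_completion
    to_completion_linear.

Lemma to_completion_norm (y : Y) : completion_norm (to_completion y) = nrm y.
Proof.
apply: (cvg_unique _ (@completion_normE _ _ p0 _ _ nrmP _)) => //=.
exact: cvg_cst.
Qed.

Lemma to_completion_near (u : cauchySeq nrm) (e : R) : 0 < e ->
  exists n0, forall n, (n0 <= n)%N ->
    completion_norm (completion_pi p0 nrmP u - to_completion (u n)) < e.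
Proof.
move=> e0; have /asboolP cu := cauchy_valP u.
have [n0 h] := cu _ (divr_gt0 e0 (ltr0n R 2)); exists n0 => n hn.
rewrite /to_completion -linearB/=.
apply: (@le_lt_trans _ _ (e / 2)); last by rewrite ltr_pdivrMr// mulr2n mulrDr
  mulr1 ltrDl.
have H := @completion_normE _ _ p0 _ _ nrmP (u - CauchySeq (cst_cauchy (u n))).
apply: (cvgr_to_le (H p p0 nrmP p p0 nrmP)); exists n0 => // m hm.
by apply/ltW; exact: h.
Qed.

Lemma to_completion_dense (x : completion p0 nrmP) (e : R) : 0 < e ->
  exists y, completion_norm (x - to_completion y) < e.
Proof.
move=> e0; rewrite -[x]completion_reprK.
by have [n0 /(_ n0 (leqnn _)) h] := to_completion_near (repr x) e0; exists (repr x n0).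
Qed.

Lemma completion_complete (x : nat -> completion p0 nrmP) :
  seq_cauchy (@completion_norm _ _ p0 _ _ nrmP) x -> exists l, forall e, 0 < e ->
  exists n0, forall n, (n0 <= n)%N -> completion_norm (x n - l) < e.
Proof.
move=> cx; have /choice[y hy] n : exists y,
    completion_norm (x n - to_completion y) < n.+1%:R^-1.
  by apply: to_completion_dense; rewrite invr_gt0.
have [nP _] := @completion_normP _ _ p0 _ _ nrmP.
have [n_ge0 nZ _] := nP.
have nN z : completion_norm (- z : completion p0 nrmP) = completion_norm z.
  by rewrite -scaleN1r nZ normrN normr1 mul1r.
have small (e : R) : 0 < e -> exists n0, forall n, (n0 <= n)%N ->
    completion_norm (x n - to_completion (y n)) < e.
  move=> e0; have [n0 _ h] := near_infty_natSinv_lt (PosNum e0).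
  by exists n0 => n hn; apply: lt_trans (hy n) _; exact: h.
pose half (e : R) := (e `^ p / 2) `^ p^-1.
have half_gt0 e : 0 < e -> 0 < half e.
  by move=> e0; rewrite powR_gt0// divr_gt0// powR_gt0.
have cy : y \in cauchy_pred nrm.
  apply/asboolP => e e0.
  have [n1 h1] := small _ (half_gt0 _ e0).
  have [n2 h2] := cx _ (half_gt0 _ (half_gt0 _ e0)).
  have [n3 h3] := small _ (half_gt0 _ (half_gt0 _ e0)).
  exists (maxn n1 (maxn n2 n3)) => m n; rewrite !geq_max.
  move=> /and3P[m1 m2 m3] /and3P[k1 k2 k3].
  rewrite -to_completion_norm linearB/=.
  have -> : to_completion (y m) - to_completion (y n) =
     - (x m - to_completion (y m)) + ((x m - x n) + (x n - to_completion (y n))).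
    by rewrite opprB [x m - x n + _]subrKA subrKA.
  apply: (seminormD_lt p0 nP) => //; first by rewrite nN; exact: h1.
  by apply: (seminormD_lt p0 nP); [exact: half_gt0|exact: h2|exact: h3].
exists (completion_pi p0 nrmP (CauchySeq cy)) => e e0.
have [n1 h1] := small _ (half_gt0 _ e0).
have [n2 h2] := to_completion_near (CauchySeq cy) (half_gt0 _ e0).
exists (maxn n1 n2) => n; rewrite geq_max => /andP[hn1 hn2].
rewrite -(subrKA (to_completion (y n))).
apply: (seminormD_lt p0 nP) => //; first exact: h1.
by rewrite -nN opprB; exact: h2.
Qed.

End CompletionEmbedding.

(** The free space only depends on the distance and the base point, so it is
    available in particular for a q-metric with p <= q. *)
Section FreeSpace.
Variables (R : realType) (p : R).
Hypothesis p0 : 0 < p.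
Variables (q : R) (M : pointedPMetric q).

Definition fun0 := {f : M -> R | f (base M) = 0}.

Definition evaluation (x : M) : fun0 -> R^o := fun f => sval f x.

Definition comb (Y : lmodType R) (f : M -> Y) (s : seq (R * M)) : Y :=
  \sum_(ax <- s) ax.1 *: f ax.2.

Definition molecule_pred : {pred fun0 -> R^o} :=
  fun mu => `[< exists s, mu = comb evaluation s >].

Lemma comb_cat (Y : lmodType R) (f : M -> Y) s t :
  comb f (s ++ t) = comb f s + comb f t.
Proof. exact: big_cat. Qed.

Definition scale_comb (a : R) (s : seq (R * M)) := [seq (a * ax.1, ax.2) | ax <- s].

Lemma comb_scale (Y : lmodType R) (f : M -> Y) a s :
  comb f (scale_comb a s) = a *: comb f s.
Proof.
rewrite /comb big_map scaler_sumr; apply: eq_bigr => ax _ /=.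
by rewrite scalerA.
Qed.

Lemma molecule_closed : submod_closed molecule_pred.
Proof.
split; first by apply/asboolP; exists [::]; rewrite /comb big_nil.
move=> a mu nu /asboolP[s ->] /asboolP[t ->]; apply/asboolP.
by exists (scale_comb a s ++ t); rewrite comb_cat comb_scale.
Qed.

HB.instance Definition _ :=
  GRing.isSubmodClosed.Build R (fun0 -> R^o) molecule_pred molecule_closed.

Record molecule := Molecule {
  molecule_val :> fun0 -> R^o;
  molecule_valP : molecule_val \in molecule_pred }.

HB.instance Definition _ := [isSub for molecule_val].
HB.instance Definition _ := [Choice of molecule by <:].
HB.instance Definition _ := [SubChoice_isSubLmodule of molecule by <:].

Definition lipschitz1 (Y : pNormed p) (f : M -> Y) :=
  forall x y, pnorm (f x - f y) <= dist x y.

Definition free_values (mu : molecule) : set R :=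
  [set r | exists (Y : pNormed p) (f : M -> Y),
     [/\ f (base M) = 0, lipschitz1 f
       & exists2 s, molecule_val mu = comb evaluation s
                  & r = pnorm (comb f s)]].

(** The values for given Y and f do not depend on the representation s of mu
    (comb_eq), and they are bounded (free_values_ub), so that sup is a genuine
    supremum. *)
Definition free_norm (mu : molecule) : R := sup (free_values mu).

Lemma comb_eq0 (Y : lmodType R) (f : M -> Y) s : f (base M) = 0 ->
  comb evaluation s = 0 -> comb f s = 0.
Proof.
move=> f0; have [n] := ubnP (size s); elim: n s => // n IH [|[a x] s] /=; rewrite ltnS => sn h.
  by rewrite /comb big_nil.
pose P (ax : R * M) := `[< ax.2 = x >].
pose t := [seq ax <- (a, x) :: s | ~~ P ax].
have split_comb (Z : lmodType R) (g : M -> Z) : comb g ((a, x) :: s) =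
    (\sum_(ax <- (a, x) :: s | P ax) ax.1) *: g x + comb g t.
  rewrite /comb (bigID P) /= [in RHS]big_filter; congr +%R.
  by rewrite scaler_suml; apply: eq_bigr => ax /asboolP ->.
have [xb|xb] := pselect (x = base M).
  rewrite split_comb xb f0 scaler0 add0r; apply: IH.
    rewrite /t /= /P /=; case: asboolP => //= _.
    by apply: leq_ltn_trans sn; rewrite size_filter count_size.
  move: h; rewrite split_comb xb => <-.
  suff -> : evaluation (base M) = 0 by rewrite scaler0 add0r.
  by apply/funext => g; exact: (svalP g).
pose ind y : R := (`[< y = x >])%:R.
have ind0 : ind (base M) = 0 by rewrite /ind; case: asboolP => // /esym.
pose g : fun0 := exist _ ind ind0.
have c0 : \sum_(ax <- (a, x) :: s | P ax) ax.1 = 0.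
  have : comb evaluation ((a, x) :: s) g = 0 by rewrite h.
  have -> : comb evaluation ((a, x) :: s) g =
      \sum_(ax <- (a, x) :: s) ax.1 * (P ax)%:R by rewrite /comb fct_sumE.
  rewrite (bigID P) /= [X in _ + X]big1 ?addr0 => [|ax /negPf ->]; last first.
    exact: mulr0.
  move=> {2}<-; apply: eq_bigr => ax Pax.
  by rewrite Pax mulr1.
rewrite split_comb c0 scale0r add0r; apply: IH.
  rewrite /t /= /P /=; case: asboolP => //= _.
  by apply: leq_ltn_trans sn; rewrite size_filter count_size.
by move: h; rewrite split_comb c0 scale0r add0r.
Qed.

Lemma comb_eq (Y : lmodType R) (f : M -> Y) s t : f (base M) = 0 ->
  comb evaluation s = comb evaluation t -> comb f s = comb f t.
Proof.
move=> f0 h; apply/eqP; rewrite -subr_eq0 -scaleN1r -comb_scale -comb_cat.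
by rewrite comb_eq0// comb_cat comb_scale scaleN1r h subrr.
Qed.

Lemma pnorm0 (Y : pNormed p) : pnorm (0 : Y) = 0.
Proof.
by have [[_ nZ _] _] := pnormP Y; rewrite -(scale0r (0 : Y)) nZ normr0 mul0r.
Qed.

Lemma free_values_ub mu : has_ubound (free_values mu).
Proof.
have /asboolP[s0 hs0] := molecule_valP mu.
exists ((\sum_(ax <- s0) (`|ax.1| * dist ax.2 (base M)) `^ p) `^ p^-1).
move=> r [Y [f [f0 fL [s hs ->]]]].
have [[n0 nZ nD] _] := pnormP Y.
rewrite (comb_eq f0 (etrans (esym hs) hs0)) -[leLHS](powRK p0)//.
apply: powR_le; rewrite ?invr_gt0 ?powR_ge0//.
rewrite /comb; elim/big_rec2: _ => [|ax y z _ yz].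
  by rewrite pnorm0 powR0// gt_eqF.
apply: le_trans (nD _ _) _; rewrite lerD//.
apply: powR_le => //; rewrite nZ ler_wpM2l//.
by rewrite -[f _]subr0 -f0.
Qed.

Lemma free_norm_le mu c : 0 <= c -> ubound (free_values mu) c ->
  free_norm mu <= c.
Proof.
move=> c0 uc; rewrite /free_norm.
have [->|/set0P ne] := eqVneq (free_values mu) set0; first by rewrite sup0.
exact: ge_sup.
Qed.

Lemma free_norm_ge0 mu : 0 <= free_norm mu.
Proof.
rewrite /free_norm; have [->|/set0P[r rmu]] := eqVneq (free_values mu) set0.
  by rewrite sup0.
apply: le_trans (ub_le_sup (free_values_ub mu) rmu).
by case: rmu => Y [f [_ _ [s _ ->]]]; have [[? _ _] _] := pnormP Y.
Qed.

Lemma free_seminormP : is_pseminorm p free_norm.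
Proof.
have Zle a mu : free_norm (a *: mu) <= `|a| * free_norm mu.
  apply: free_norm_le; first by rewrite mulr_ge0 ?free_norm_ge0.
  move=> r [Y [f [f0 fL [s hs ->]]]].
  have /asboolP[t ht] := molecule_valP mu.
  have [[_ nZ _] _] := pnormP Y.
  have -> : comb f s = a *: comb f t.
    rewrite -comb_scale; apply: comb_eq => //.
    by rewrite comb_scale -ht -hs.
  rewrite nZ ler_wpM2l// ub_le_sup//; first exact: free_values_ub.
  by exists Y, f; split => //; exists t.
split; first exact: free_norm_ge0.
- move=> a mu; apply/le_anti; rewrite Zle/=.
  have [->|a0] := eqVneq a 0; first by rewrite normr0 mul0r free_norm_ge0.
  have := Zle a^-1 (a *: mu); rewrite scalerA mulVf// scale1r normfV.
  by rewrite mulrC ler_pdivlMr ?normr_gt0// mulrC.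
- move=> mu nu.
  have c0 : 0 <= free_norm mu `^ p + free_norm nu `^ p.
    by rewrite addr_ge0 ?powR_ge0.
  rewrite -[leRHS](powRVK p0)//; apply: powR_le => //; first exact: free_norm_ge0.
  apply: free_norm_le; first exact: powR_ge0.
  move=> r [Y [f [f0 fL [s hs ->]]]].
  have /asboolP[t ht] := molecule_valP mu.
  have /asboolP[u hu] := molecule_valP nu.
  have [[n0 _ nD] _] := pnormP Y.
  have -> : comb f s = comb f t + comb f u.
    rewrite -comb_cat; apply: comb_eq => //.
    by rewrite comb_cat -ht -hu -hs.
  rewrite -[leLHS](powRK p0)//; apply: powR_le; rewrite ?invr_gt0 ?powR_ge0//.
  apply: le_trans (nD _ _) _; apply: lerD; apply: powR_le => //.
    apply: ub_le_sup; first exact: free_values_ub.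
    by exists Y, f; split => //; exists t.
  apply: ub_le_sup; first exact: free_values_ub.
  by exists Y, f; split => //; exists u.
Qed.

Definition lipschitz_free : pNormed p :=
  PNormed (completion_normP p0 free_seminormP).

Lemma evaluation_molecule x : evaluation x \in molecule_pred.
Proof.
by apply/asboolP; exists [:: (1, x)]; rewrite /comb big_seq1 scale1r.
Qed.

Definition delta (x : M) : lipschitz_free :=
  to_completion p0 free_seminormP (Molecule (evaluation_molecule x)).

End FreeSpace.

Section Operators.
Variables (R : realType) (p : R) (X Y : pNormed p).

Definition bounded_op (L : X -> Y) :=
  exists C : R, forall x, pnorm (L x) <= C * pnorm x.

Definition continuous_on (D : set X) (f : X -> Y) :=
  forall x, D x -> forall e : R, 0 < e -> exists2 d : R, 0 < d &
    forall y, D y -> pnorm (y - x) < d -> pnorm (f y - f x) < e.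

(** sup is real-valued: it is the operator norm when T is bounded on D, and 0
    when it is not. *)
Definition op_norm (D : set X) (T : X -> Y) : R :=
  sup [set pnorm (T x) | x in D `&` [set x | pnorm x <= 1]].

Definition isometric (L : X -> Y) := forall x, pnorm (L x) = pnorm x.

End Operators.

(** The inverse of L on its range; its values off the range are irrelevant. *)
Definition range_inv (R : realType) (p : R) (X Y : pNormed p) (L : X -> Y) :
  Y -> X := 'pinv_(fun=> 0) [set: X] L.

(** Continuity is with respect to the topologies given by the p-norms. *)
Definition isomorphic_embedding (R : realType) (p : R) (X Y : pNormed p)
    (L : X -> Y) :=
  [/\ linear L, injective L, continuous_on [set: X] L
    & continuous_on (range L) (range_inv L)].

Definition inclusion_induced (R : realType) (p : R) (p0 : 0 < p) (q : R)
    (M : pointedPMetric q) (N : set M) (N0 : N (base M))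
    (L : lipschitz_free p0 (restr N0) -> lipschitz_free p0 M) :=
  [/\ linear L, bounded_op L
    & forall x : N, L (delta p0 (x : restr N0)) = delta p0 (val x)].

Lemma molecule_comb (R : realType) (p : R) (p0 : 0 < p) (q : R)
    (M : pointedPMetric q) (mu : molecule M) : exists s,
  to_completion p0 (free_seminormP p0 M) mu = comb (delta p0 (M := M)) s.
Proof.
have /asboolP[s hs] := molecule_valP mu; exists s.
have -> : mu = \sum_(ax <- s) ax.1 *: Molecule (evaluation_molecule ax.2).
  apply: val_inj; rewrite raddf_sum /= [LHS]hs; exact: eq_bigr.
by rewrite linear_sum; apply: eq_bigr => ax _; rewrite linearZ.
Qed.

Lemma inclusion_induced_unique (R : realType) (p : R) (p0 : 0 < p) (q : R)
    (M : pointedPMetric q) (N : set M) (N0 : N (base M))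
    (L L' : lipschitz_free p0 (restr N0) -> lipschitz_free p0 M) :
  inclusion_induced L -> inclusion_induced L' -> L = L'.
Proof.
move=> [linL [C hC] dL] [linL' [C' hC'] dL'].
pose K (F : _ -> lipschitz_free p0 M) (linF : linear F) :=
  HB.pack_for {linear lipschitz_free p0 (restr N0) -> lipschitz_free p0 M} F
    (GRing.isLinear.Build _ _ _ _ F linF).
pose F := K _ linL; pose F' := K _ linL'.
apply/funext => x; change (F x = F' x).
have [nP nP0] := pnormP (lipschitz_free p0 M).
have [n_ge0 nZ _] := nP.
have [[m_ge0 _ _] _] := pnormP (lipschitz_free p0 (restr N0)).
apply/eqP; rewrite -subr_eq0; apply/eqP/nP0/le_anti; rewrite n_ge0 andbT.
apply/ler_addgt0Pr => e e0; rewrite add0r; apply/ltW.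
set d := (e `^ p / 2) `^ p^-1.
have d0 : 0 < d by rewrite powR_gt0// divr_gt0// powR_gt0.
have D0 : 0 < `|C| + `|C'| + 1 by rewrite ltr_pwDr// addr_ge0.
have [mu hmu] := to_completion_dense x (divr_gt0 d0 D0).
have [s hs] := molecule_comb p0 mu; rewrite hs in hmu.
have Ls : F (comb (delta p0 (M := restr N0)) s) =
          F' (comb (delta p0 (M := restr N0)) s).
  rewrite !linear_sum; apply: eq_bigr => ax _; rewrite !linearZ/=.
  by congr (_ *: _); rewrite [LHS]dL [RHS]dL'.
have -> : F x - F' x = F (x - comb (delta p0 (M := restr N0)) s)
                     + - F' (x - comb (delta p0 (M := restr N0)) s).
  by rewrite (linearB F) (linearB F') Ls opprB addrA subrK.
have bound (B : R) y : B <= `|C| + `|C'| ->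
    pnorm (x - comb (delta p0 (M := restr N0)) s) < d / (`|C| + `|C'| + 1) ->
    pnorm y <= B * pnorm (x - comb (delta p0 (M := restr N0)) s) ->
    pnorm (y : lipschitz_free p0 M) < d.
  move=> hB h1 h2; apply: le_lt_trans h2 _.
  rewrite ltr_pdivlMr// in h1; apply: le_lt_trans h1; rewrite mulrC.
  by apply: ler_wpM2l => //; apply: le_trans hB _; rewrite lerDl.
apply: (seminormD_lt p0 nP) => //.
  apply: bound hmu (hC _); apply: le_trans (ler_norm _) _.
  by rewrite lerDl.
rewrite -scaleN1r nZ normrN normr1 mul1r.
apply: bound hmu (hC' _); apply: le_trans (ler_norm _) _.
by rewrite lerDr.
Qed.

(* Main.v *)
From HB Require Import structures.
Require Import Defs.
From mathcomp Require Import all_boot all_order all_algebra.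
From mathcomp Require Import all_classical all_reals all_analysis.

(** The space M is a star: countably many leaves Some k, one of them the base
    point, and a hub None.  The hub is at distance 1 from every leaf and two
    leaves are at distance 2^(1/q), the largest value that the q-triangle
    inequality through the hub allows.  The subset N consists of the leaves.

    Sending the hub to the base leaf is a 2^(1/q)-Lipschitz retraction of M onto
    N.  By functoriality it induces a left inverse of L of norm at most 2^(1/q)
    ([free_mapK]), so that L is bounded below, hence an isomorphic embedding.

    For the lower bound consider mu_n, the sum of the point masses at n leaves
    other than the base point.  In M the n unit masses can be gathered at the
    hub and then moved together to the base point, at p-cost n + n^p
    ([star_norm_le]).  Since p < 1, moving a large mass in bulk is cheap and the
    term n^p is negligible.  In N every edge has length c = 2^(1/q), and
    gathering gains nothing: the p-cost is n c^p ([leaves_norm_ge]).  This is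
    witnessed by the Lipschitz map that sends the leaf k to c e_k, for the
    p-norm max(|a^+|_p, |a^-|_p) on R^n, where |.|_p is the usual l_p p-norm,
    a^+ the positive part of a and a^- its negative part.  For this p-norm e_i
    and e_i - e_j both have norm 1, while e_1 + ... + e_n has norm n^(1/p).
    Hence any K with |x| <= K |L x| for all x satisfies
    n c^p <= K^p (n + n^p) for every n, and K >= c follows as n tends to
    infinity ([sublinear_absorbed]).  The operator norm of the inverse is such a
    K; if L were isometric, K = 1 would be one too. *)

Set Implicit Arguments.
Unset Strict Implicit.
Unset Printing Implicit Defensive.

Import Order.TTheory GRing.Theory Num.Theory.
Import numFieldNormedType.Exports.

Local Open Scope classical_set_scope.
Local Open Scope ring_scope.

(** * Extending bounded operators to completions *)

Section CompletionMap.
Variables (R : realType) (p : R) (p0 : 0 < p).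
Variables (Y Z : lmodType R) (nY : Y -> R) (nZ : Z -> R).
Hypotheses (YP : is_pseminorm p nY) (ZP : is_pseminorm p nZ).
Variables (T : {linear Y -> Z}) (C : R).
Hypotheses (C0 : 0 < C) (TC : forall y, nZ (T y) <= C * nY y).

Let T_lt y e : nY y < e / C -> nZ (T y) < e.
Proof. by rewrite ltr_pdivlMr// mulrC; exact: le_lt_trans. Qed.

Lemma map_cauchy (u : cauchySeq nY) : (fun n => T (u n)) \in cauchy_pred nZ.
Proof.
have /asboolP cu := cauchy_valP u; apply/asboolP => e e0.
have [n0 h] := cu _ (divr_gt0 e0 C0); exists n0 => m n hm hn.
by rewrite -linearB; apply: T_lt; exact: h.
Qed.

Definition map_seq u : cauchySeq nZ := CauchySeq (map_cauchy u).

(** The values at the chosen representatives determine a well-defined map because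
    T preserves null sequences; [completion_mapE] computes it on any
    representative. *)
Definition completion_map (x : completion p0 YP) : completion p0 ZP :=
  completion_pi p0 ZP (map_seq (repr x)).

Lemma completion_mapE (u : cauchySeq nY) :
  completion_map (completion_pi p0 YP u) = completion_pi p0 ZP (map_seq u).
Proof.
apply/completion_piP/(null_predP ZP) => e e0.
set v := repr _.
have /completion_piP/(null_predP YP)/(_ _ (divr_gt0 e0 C0)) :
  completion_pi p0 YP v = completion_pi p0 YP u by exact: completion_reprK.
(* differences of Cauchy sequences are pointwise *)
apply: filterS => n vun; rewrite [cauchy_val _ _](erefl (T (v n) - T (u n))).
rewrite -linearB.
exact: T_lt.
Qed.

Lemma completion_map_linear : linear completion_map.
Proof.
move=> a x y; rewrite -[x]completion_reprK -[y]completion_reprK.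
rewrite -linearP !completion_mapE -linearP; congr completion_pi.
by apply/val_inj/funext => n; rewrite [LHS]linearP.
Qed.

Lemma completion_map_norm x :
  completion_norm (completion_map x) <= C * completion_norm x.
Proof.
rewrite -[x]completion_reprK completion_mapE.
have hZ := @completion_normE _ _ p0 _ _ ZP (map_seq (repr x)).
have hY := @completion_normE _ _ p0 _ _ YP (repr x).
have hCY : C * nY (repr x n) @[n --> \oo] -->
    C * completion_norm (completion_pi p0 YP (repr x)) by exact: cvgMr.
by apply: (ler_cvg_to hZ hCY); apply: nearW => n; exact: TC.
Qed.

Lemma completion_map_to y :
  completion_map (to_completion p0 YP y) = to_completion p0 ZP (T y).
Proof. by rewrite completion_mapE; congr completion_pi; exact/val_inj. Qed.

End CompletionMap.

(** * Free spaces and Lipschitz maps *)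

Section Pushforward.
Variables (R : realType) (p : R) (p0 : 0 < p) (q1 q2 : R).
Variables (M1 : pointedPMetric q1) (M2 : pointedPMetric q2) (h : M1 -> M2).
Hypothesis h0 : h (base M1) = base M2.

Definition precomp (g : fun0 M2) : fun0 M1 :=
  exist _ (sval g \o h) (etrans (congr1 (sval g) h0) (svalP g)).

Definition map_comb (s : seq (R * M1)) : seq (R * M2) :=
  [seq (ax.1, h ax.2) | ax <- s].

Lemma comb_map (Y : lmodType R) (f : M2 -> Y) s :
  comb f (map_comb s) = comb (f \o h) s.
Proof. by rewrite /comb big_map. Qed.

Lemma comb_evaluation_precomp s :
  comb (@evaluation _ _ M1) s \o precomp = comb (@evaluation _ _ M2) (map_comb s).
Proof.
rewrite comb_map; apply/funext => g /=.
by rewrite /comb !fct_sumE; apply: eq_bigr.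
Qed.

Lemma pushforward_molecule (mu : molecule M1) :
  (molecule_val mu \o precomp : fun0 M2 -> R^o) \in molecule_pred (M := M2).
Proof.
have /asboolP[s ->] := molecule_valP mu; apply/asboolP.
by exists (map_comb s); exact: comb_evaluation_precomp.
Qed.

(** Molecules are functionals, so they are pushed forward by evaluating them at
    the functions g o h; this is linear by definition and
    independent of any representation by point masses. *)
Definition pushforward mu : molecule M2 := Molecule (pushforward_molecule mu).

Lemma pushforward_linear : linear pushforward.
Proof. by move=> a mu nu; exact/val_inj. Qed.

HB.instance Definition _ := GRing.isLinear.Build R (molecule M1) (molecule M2)
  *:%R pushforward pushforward_linear.

Lemma pushforward_evaluation x :
  pushforward (Molecule (evaluation_molecule x)) =
  Molecule (evaluation_molecule (h x)).
Proof. exact/val_inj. Qed.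

Variable C : R.
Hypotheses (C0 : 0 < C) (hC : forall x y, dist (h x) (h y) <= C * dist x y).

(** A 1-Lipschitz f on M2 becomes the C-Lipschitz map f o h on M1; dividing by C
    makes it an admissible competitor for the norm of mu. *)
Lemma pushforward_norm mu :
  free_norm p (pushforward mu) <= C * free_norm p mu.
Proof.
apply: free_norm_le; first exact: mulr_ge0 (ltW C0) (free_norm_ge0 p0 _).
move=> r [Y [f [f0 fL [t ht ->]]]].
have [[_ nZ _] _] := pnormP Y.
have /asboolP[s hs] := molecule_valP mu.
have -> : comb f t = C *: comb (fun x => C^-1 *: f (h x)) s.
  rewrite (comb_eq (t := map_comb s) f0); last first.
    by rewrite -ht -comb_evaluation_precomp -hs.
  rewrite comb_map /comb scaler_sumr; apply: eq_bigr => ax _ /=.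
  by rewrite !scalerA mulrAC divff ?mul1r// gt_eqF.
rewrite nZ gtr0_norm// ler_pM2l//.
apply: ub_le_sup; first exact: free_values_ub.
exists Y, (fun x => C^-1 *: f (h x)); split; last by exists s.
  by rewrite h0 f0 scaler0.
move=> x y; rewrite -scalerBr nZ gtr0_norm ?invr_gt0// mulrC ler_pdivrMr//.
by rewrite mulrC; exact: le_trans (fL _ _) (hC _ _).
Qed.

Definition free_map : lipschitz_free p0 M1 -> lipschitz_free p0 M2 :=
  completion_map (YP := free_seminormP p0 M1) (free_seminormP p0 M2)
    C0 pushforward_norm.

Lemma free_map_delta x : free_map (delta p0 x) = delta p0 (h x).
Proof. by rewrite /free_map completion_map_to /= pushforward_evaluation. Qed.

End Pushforward.

Section Retract.
Variables (R : realType) (p : R) (p0 : 0 < p) (q1 q2 : R).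
Variables (M1 : pointedPMetric q1) (M2 : pointedPMetric q2).
Variables (h : M1 -> M2) (h0 : h (base M1) = base M2).
Variables (r : M2 -> M1) (r0 : r (base M2) = base M1).
Hypothesis rh : cancel h r.
Variables (C D : R) (C0 : 0 < C) (D0 : 0 < D).
Hypothesis hC : forall x y, dist (h x) (h y) <= C * dist x y.
Hypothesis rD : forall x y, dist (r x) (r y) <= D * dist x y.

(** The free space of a Lipschitz retract is complemented in the large free
    space.  Functoriality holds already on representing Cauchy sequences, since
    evaluating the twice pushed molecule at g is evaluating it at g o r o h = g. *)
Lemma free_mapK : cancel (free_map (p0 := p0) h0 C0 hC) (free_map r0 D0 rD).
Proof.
move=> x; rewrite -[x]completion_reprK /free_map !completion_mapE.
congr completion_pi; apply/val_inj/funext => n /=; apply/val_inj/funext => g /=.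
congr (molecule_val _ _); case: g => g g0; apply: eq_exist => /=.
by apply/funext => y /=; rewrite rh.
Qed.

End Retract.

(** * Linear maps bounded above and below *)

Section BoundedBelow.
Variables (R : realType) (p : R) (X Y : pNormed p) (L : X -> Y).
Hypothesis linL : linear L.
Variables (C D : R).
Hypotheses (C0 : 0 < C) (LC : forall x, pnorm (L x) <= C * pnorm x).
Hypotheses (D0 : 0 < D) (LD : forall x, pnorm x <= D * pnorm (L x)).

Let LB x y : L x - L y = L (x - y).
Proof. by rewrite addrC -scaleN1r -linL scaleN1r addrC. Qed.

Let L0 : L 0 = 0. Proof. by rewrite -(subrr 0) -LB subrr. Qed.

Let injL : injective L.
Proof.
move=> x y Lxy; apply/eqP; rewrite -subr_eq0; apply/eqP.
have [[n0 _ _] n_eq0] := pnormP X; apply: n_eq0; apply/le_anti.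
by rewrite n0 andbT (le_trans (LD _))// -LB Lxy subrr pnorm0 mulr0.
Qed.

Let range_invK x : range_inv L (L x) = x.
Proof. by apply: pinvKV (mem_set _) => // u v _ _; exact: injL. Qed.

Lemma bounded_below_embedding : isomorphic_embedding L.
Proof.
split=> //.
- move=> x _ e e0; exists (e / C) => [|y _]; first exact: divr_gt0.
  by rewrite LB ltr_pdivlMr// mulrC; exact: le_lt_trans.
- move=> _ [x _ <-] e e0; exists (e / D) => [|_ [y _ <-]]; first exact: divr_gt0.
  rewrite !range_invK LB ltr_pdivlMr// mulrC; exact: le_lt_trans.
Qed.

(** The operator norm is a real supremum, which would be 0 for an unbounded
    inverse; it is meaningful here because D bounds the inverse on the range. *)
Lemma op_norm_range_inv x :
  pnorm x <= op_norm (range L) (range_inv L) * pnorm (L x).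
Proof.
have [[n0 nZ _] _] := pnormP X; have [[m0 mZ _] m_eq0] := pnormP Y.
have [Lx0|Lx0] := eqVneq (pnorm (L x)) 0.
  by rewrite Lx0 mulr0 (le_trans (LD x))// Lx0 mulr0.
have Lx_gt0 : 0 < pnorm (L x) by rewrite lt_neqAle eq_sym Lx0 m0.
have LZ a : L (a *: x) = a *: L x by rewrite -[a *: x]addr0 linL L0 addr0.
rewrite -ler_pdivrMr// mulrC -[_^-1]gtr0_norm ?invr_gt0// -nZ.
apply: ub_le_sup.
  exists D => _ [_ [[y _ <-] /= Ly1] <-]; rewrite range_invK.
  by apply: le_trans (LD y) _; rewrite ger_pMr.
exists (L ((pnorm (L x))^-1 *: x)); last by rewrite range_invK.
split; first by exists ((pnorm (L x))^-1 *: x).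
by rewrite /= LZ mZ gtr0_norm ?invr_gt0// mulVf.
Qed.

End BoundedBelow.

Lemma op_norm_ge0 (R : realType) (p : R) (X Y : pNormed p) (D : set X)
    (T : X -> Y) : 0 <= op_norm D T.
Proof.
rewrite /op_norm; set E := [set _ | x in _].
have [[[y [x Dx _]] ubE]|noE] := pselect (has_sup E); last by rewrite sup_out.
apply: le_trans (ub_le_sup ubE _); last by exists x.
by have [[n0 _ _] _] := pnormP Y; exact: n0.
Qed.

(** * A p-norm that charges positive and negative parts separately *)

(** With t = x / (x + y) and 1 - t = y / (x + y) this is t^p + (1 - t)^p >= 1,
    which follows from t^p >= t on [0, 1]. *)
Lemma powR_subadd (R : realType) (p x y : R) : 0 < p -> p <= 1 ->
  0 <= x -> 0 <= y -> (x + y) `^ p <= x `^ p + y `^ p.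
Proof.
move=> p0 p1 x0 y0; have [s0|s0] := eqVneq (x + y) 0.
  by rewrite s0 powR0 ?gt_eqF// addr_ge0 ?powR_ge0.
have s_gt0 : 0 < x + y by rewrite lt_neqAle eq_sym s0 addr_ge0.
have part z : 0 <= z -> z <= x + y -> z / (x + y) * (x + y) `^ p <= z `^ p.
  rewrite le_eqVlt => /orP[/eqP <- _|z0 zs]; first by rewrite !mul0r powR_ge0.
  have -> : z `^ p = (z / (x + y)) `^ p * (x + y) `^ p.
    by rewrite -powRM ?divr_ge0 ?ltW// divfK.
  rewrite ler_wpM2r ?powR_ge0// ger1_powR//.
  by rewrite divr_gt0//= ler_pdivrMr// mul1r.
have hx : x <= x + y by rewrite lerDl.
have hy : y <= x + y by rewrite lerDr.
apply: le_trans _ (lerD (part _ x0 hx) (part _ y0 hy)).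
by rewrite -mulrDl -mulrDl divff// mul1r.
Qed.

Section SplitNorm.
Variables (R : realType) (p : R) (p0 : 0 < p) (p1 : p <= 1) (I : finType).
Implicit Types a b : {ffun I -> R}.

Definition pos_energy a : R := \sum_i Num.max (a i) 0 `^ p.

(** The larger of the l_p sizes of the positive and of the negative part.  Unlike
    in l_p, the difference of two unit vectors has norm 1. *)
Definition split_norm a : R :=
  Num.max (pos_energy a) (pos_energy (- a)) `^ p^-1.

Lemma pos_energy_ge0 a : 0 <= pos_energy a.
Proof. by apply: sumr_ge0 => i _; exact: powR_ge0. Qed.

Lemma pos_energy_le a b : (forall i, a i <= b i) -> pos_energy a <= pos_energy b.
Proof.
move=> ab; apply: ler_sum => i _; apply: powR_le => //.
  by rewrite le_max lexx orbT.
by rewrite ge_max !le_max ab lexx orbT.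
Qed.

(** The positive part is subadditive, and so is t |-> t^p for p <= 1. *)
Lemma pos_energyD a b : pos_energy (a + b) <= pos_energy a + pos_energy b.
Proof.
rewrite -big_split; apply: ler_sum => i _ /=.
apply: le_trans (powR_subadd p0 p1 _ _); rewrite ?le_max ?lexx ?orbT//.
apply: powR_le => //; first by rewrite le_max lexx orbT.
by rewrite ffunE ge_max lerD ?addr_ge0 ?le_max ?lexx ?orbT.
Qed.

Lemma pos_energyZ c a : 0 <= c -> pos_energy (c *: a) = c `^ p * pos_energy a.
Proof.
move=> c0; rewrite mulr_sumr; apply: eq_bigr => i _.
by rewrite -powRM ?le_max ?lexx ?orbT// maxr_pMr// mulr0 ffunE.
Qed.

Lemma split_normE a :
  split_norm a `^ p = Num.max (pos_energy a) (pos_energy (- a)).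
Proof. by rewrite powRVK// le_max pos_energy_ge0. Qed.

Lemma split_norm_le a c : 0 <= c ->
  pos_energy a <= c `^ p -> pos_energy (- a) <= c `^ p -> split_norm a <= c.
Proof.
move=> c0 ha hNa; apply: (powR_leV p0) => //; first exact: powR_ge0.
by rewrite split_normE ge_max ha.
Qed.

Lemma split_normD a b :
  split_norm (a + b) `^ p <= split_norm a `^ p + split_norm b `^ p.
Proof.
have le_l (u v : R) : u <= Num.max u v by rewrite le_max lexx.
have le_r (u v : R) : v <= Num.max u v by rewrite le_max lexx orbT.
rewrite [X in X <= _]split_normE [X in _ <= X + _]split_normE.
rewrite [X in _ <= _ + X]split_normE ge_max.
apply/andP; split.
  exact: le_trans (pos_energyD a b) (lerD (le_l _ _) (le_l _ _)).
rewrite opprD.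
exact: le_trans (pos_energyD _ _) (lerD (le_r _ _) (le_r _ _)).
Qed.

Lemma split_normP : is_pnorm p split_norm.
Proof.
split; first split.
- by move=> a; exact: powR_ge0.
- move=> c a.
  have nonneg d b : 0 <= d -> split_norm (d *: b) = d * split_norm b.
    move=> d0; rewrite /split_norm -scalerN !pos_energyZ//.
    rewrite -maxr_pMr ?powR_ge0// powRM ?powR_ge0// ?powRK//.
    by rewrite le_max pos_energy_ge0.
  have [c0|/ltW c0] := leP 0 c; first by rewrite nonneg// ger0_norm.
  have -> : c *: a = - c *: - a by rewrite scalerN scaleNr opprK.
  have -> : split_norm (- c *: - a) = - c * split_norm (- a).
    by apply: nonneg; rewrite oppr_ge0.
  by rewrite (ler0_norm c0) /split_norm opprK maxC.
- exact: split_normD.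
- move=> a /(congr1 (fun t => t `^ p)); rewrite split_normE powR0 ?gt_eqF//.
  move=> m0; have nonpos b : pos_energy b <= 0 -> forall i, b i <= 0.
    move=> hb i; have e0 : pos_energy b = 0.
      by apply/le_anti; rewrite hb pos_energy_ge0.
    have /allP/(_ i (mem_index_enum _)) : all (fun i => true ==>
        (Num.max (b i) 0 `^ p == 0)) (index_enum I).
      by rewrite -psumr_eq0 ?[X in X == 0]e0// => j _; exact: powR_ge0.
    by rewrite powR_eq0 => /andP[/eqP <- _]; rewrite le_max lexx.
  have ha : pos_energy a <= 0 by rewrite -m0 le_max lexx.
  have hNa : pos_energy (- a) <= 0 by rewrite -m0 le_max lexx orbT.
  apply/ffunP => i; rewrite ffunE; apply/le_anti; rewrite nonpos//=.
  by have := nonpos _ hNa i; rewrite ffunE oppr_le0.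
Qed.

Definition split_space : pNormed p := PNormed split_normP.

End SplitNorm.

(** * Norms of explicit molecules *)

Section Molecules.
Variables (R : realType) (p : R) (p0 : 0 < p) (q : R).
Variable M : pointedPMetric q.

Lemma comb_molecule_subproof (s : seq (R * M)) :
  comb (@evaluation _ _ M) s \in molecule_pred (M := M).
Proof. by apply/asboolP; exists s. Qed.

Definition comb_molecule s : molecule M := Molecule (comb_molecule_subproof s).

Lemma le_free_norm (Y : pNormed p) (f : M -> Y) s :
  f (base M) = 0 -> lipschitz1 f ->
  pnorm (comb f s) <= free_norm p (comb_molecule s).
Proof.
move=> f0 fL; apply: ub_le_sup; first exact: free_values_ub.
by exists Y, f; split => //; exists s.
Qed.

Lemma free_norm_comb_le s c : 0 <= c ->
  (forall (Y : pNormed p) (f : M -> Y), f (base M) = 0 -> lipschitz1 f ->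
     pnorm (comb f s) <= c) ->
  free_norm p (comb_molecule s) <= c.
Proof.
move=> c0 hc; apply: free_norm_le => // r [Y [f [f0 fL [t ht ->]]]].
by rewrite (comb_eq f0 (t := s)) ?hc// -ht.
Qed.

End Molecules.

Lemma free_map_comb (R : realType) (p : R) (p0 : 0 < p) (q1 q2 : R)
    (M1 : pointedPMetric q1) (M2 : pointedPMetric q2) (h : M1 -> M2)
    (h0 : h (base M1) = base M2) (C : R) (C0 : 0 < C)
    (hC : forall x y, dist (h x) (h y) <= C * dist x y) s :
  free_map h0 C0 hC (to_completion p0 (free_seminormP p0 M1) (comb_molecule s)) =
  to_completion p0 (free_seminormP p0 M2) (comb_molecule (map_comb h s)).
Proof.
rewrite /free_map completion_map_to; congr to_completion.
by apply/val_inj; exact: comb_evaluation_precomp.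
Qed.

Lemma pnorm_sum (R : realType) (p : R) (p0 : 0 < p) (Y : pNormed p)
    (I : Type) (r : seq I) (y : I -> Y) :
  pnorm (\sum_(i <- r) y i) `^ p <= \sum_(i <- r) pnorm (y i) `^ p.
Proof.
have [[_ _ nD] _] := pnormP Y.
elim/big_rec2: _ => [|i u v _ uv]; first by rewrite pnorm0 powR0 ?gt_eqF.
by apply: le_trans (nD _ _) _; rewrite lerD2l.
Qed.

(** * The star space *)

(** The q-th power of the distance: the triangle inequality becomes one between
    small natural numbers. *)
Definition star_weight (x y : option nat) : nat :=
  if x == y then 0 else if (x == None) || (y == None) then 1 else 2.

Section Star.
Variables (R : realType) (q : R) (q0 : 0 < q).

Definition star_dist (x y : option nat) : R := (star_weight x y)%:R `^ q^-1.

Lemma star_dist_q x y : star_dist x y `^ q = (star_weight x y)%:R.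
Proof. by rewrite powRVK. Qed.

Lemma star_distP : is_pmetric q star_dist.
Proof.
split=> [x y|x y|x y|x y z]; first exact: powR_ge0.
- rewrite /star_dist /star_weight; have [->|/eqP xy] := eqVneq x y.
    by rewrite powR0// invr_neq0// gt_eqF.
  split=> [/powR_eq0_eq0/eqP|/xy//].
  by case: ifP => _; rewrite pnatr_eq0.
- by rewrite /star_dist /star_weight eq_sym orbC.
- rewrite !star_dist_q -natrD ler_nat.
  have [->|xy] := eqVneq x y; first by rewrite /star_weight eqxx.
  case: x y z xy => [x|] [y|] [z|] //; rewrite /star_weight /=;
    by do ?case: eqP => //; congruence.
Qed.

Definition star : pointedPMetric q := PointedPMetric (Some 0%N) star_distP.

Definition leaves : set star := [set x | x != None].

Lemma leaves_Some k : leaves (Some k). Proof. by []. Qed.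

Definition rim : pointedPMetric q := restr (leaves_Some 0 : leaves (base star)).

Definition leaf (k : nat) : rim := exist _ (Some k) (mem_set (leaves_Some k)).

Definition collapse (x : star) : rim := leaf (odflt 0%N x).

Definition inclusion : rim -> star := val.

Lemma inclusionK : cancel inclusion collapse.
Proof.
by move=> [[k|] hx]; apply: val_inj => //=; case: (set_mem hx).
Qed.

Lemma inclusion_lipschitz x y :
  dist (inclusion x) (inclusion y) <= 1 * dist x y.
Proof. by rewrite mul1r. Qed.

Lemma collapse_lipschitz x y :
  dist (collapse x) (collapse y) <= 2 `^ q^-1 * dist x y.
Proof.
rewrite -powRM// -natrM; apply: powR_le; rewrite ?invr_gt0// ler_nat.
case: x y => [x|] [y|] //=; rewrite /star_weight /=.
by do ?case: eqP => //; congruence.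
by case: ifP.
by case: ifP.
Qed.

(** The masses start at leaf 1, because the point mass at the base point vanishes. *)
Definition leaf_sum n : seq (R * rim) :=
  [seq (1, leaf i.+1) | i : 'I_n].

Lemma comb_leaf_sum (Y : lmodType R) (f : rim -> Y) n :
  comb f (leaf_sum n) = \sum_(i < n) f (leaf i.+1).
Proof.
by rewrite /comb big_image /=; apply: eq_bigr => i _; rewrite scale1r.
Qed.

Variables (p : R) (p0 : 0 < p) (p1 : p <= 1).

(** Transport through the hub: n unit edges of mass 1 carry the mass to the hub,
    one unit edge of mass n carries it on to the base point. *)
Lemma star_norm_le n :
  free_norm p (comb_molecule (map_comb inclusion (leaf_sum n))) `^ p <=
  n%:R + n%:R `^ p.
Proof.
rewrite -[leRHS](powRVK p0) ?addr_ge0 ?powR_ge0//.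
apply: powR_le => //; first exact: free_norm_ge0.
apply: free_norm_comb_le => [|Y f f0 fL]; first exact: powR_ge0.
apply: (powR_leV p0); rewrite ?powR_ge0 ?powRVK ?addr_ge0 ?powR_ge0//.
  by have [[]] := pnormP Y.
have [[n_ge0 nZ nD] _] := pnormP Y.
have -> : comb f (map_comb inclusion (leaf_sum n)) =
    \sum_(i < n) (f (Some i.+1) - f None) + n%:R *: f None.
  rewrite comb_map comb_leaf_sum sumrB sumr_const card_ord scaler_nat subrK.
  by [].
have edge x y : x != y -> x == None \/ y == None ->
    pnorm (f x - f y) `^ p <= 1.
  move=> xy xyN; have -> : 1 = 1 `^ p :> R by rewrite powR1.
  apply: powR_le => //.
  apply: le_trans (fL _ _) _; rewrite /dist /= /star_dist /star_weight.
  by rewrite (negPf xy); case: xyN => ->; rewrite ?orbT /= powR1.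
apply: le_trans (nD _ _) _; apply: lerD.
  apply: le_trans (pnorm_sum p0 _ _) _.
  apply: le_trans (_ : \sum_(i < n) 1 <= _).
    by apply: ler_sum => i _; apply: edge => //; right.
  by rewrite sumr_const card_ord.
rewrite nZ ger0_norm// powRM// -[leRHS]mulr1 ler_wpM2l ?powR_ge0//.
by rewrite -[f None]subr0 -f0; apply: edge => //; left.
Qed.

Definition leaf_coordinates n (x : rim) :
    split_space p0 p1 'I_n :=
  [ffun i : 'I_n => 2 `^ q^-1 * (val x == Some i.+1)%:R].

Lemma leaf_coordinates_energy n x :
  pos_energy p (leaf_coordinates n x) <= (2 `^ q^-1) `^ p.
Proof.
have [i /eqP xi|nx] := pickP (fun i : 'I_n => val x == Some i.+1).
  rewrite /pos_energy (bigD1 i)//= big1 => [|j ji].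
    rewrite addr0 ffunE xi eqxx mulr1; apply: powR_le => //.
    by rewrite ge_max lexx powR_ge0.
  rewrite ffunE xi; case: eqP => [[/val_inj ij]|_].
    by rewrite ij eqxx in ji.
  by rewrite mulr0 maxxx powR0// gt_eqF.
rewrite /pos_energy big1 ?powR_ge0// => i _.
by rewrite ffunE nx mulr0 maxxx powR0// gt_eqF.
Qed.

(** A difference of two values is bounded above by the first one, and its
    opposite by the second one: the coordinates are nonnegative.  So neither its
    positive nor its negative part exceeds the energy of a single leaf. *)
Lemma leaf_coordinates_lipschitz n : lipschitz1 (@leaf_coordinates n).
Proof.
move=> x y; have [->|xy] := eqVneq x y.
  by rewrite subrr pnorm0; exact: powR_ge0.
have -> : dist x y = 2 `^ q^-1.
  rewrite /dist /= /restr_dist /dist /= /star_dist /star_weight.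
  rewrite (inj_eq val_inj) (negPf xy).
  by case: x y {xy} => [[?|] hx] [[?|] hy] //=;
    by [case: (set_mem hx) | case: (set_mem hy)].
have le_coord (u v : rim) :
    pos_energy p (leaf_coordinates n u - leaf_coordinates n v) <= (2 `^ q^-1) `^ p.
  apply: le_trans (leaf_coordinates_energy n u).
  apply: pos_energy_le => // i; rewrite !ffunE gerBl.
  by rewrite mulr_ge0 ?powR_ge0.
by apply: split_norm_le => //; rewrite opprB.
Qed.

(** The coordinate map is a competitor for the norm; it sends the molecule to the
    vector with all n coordinates equal to c = 2^(1/q). *)
Lemma leaves_norm_ge n :
  n%:R * (2 `^ q^-1) `^ p <= free_norm p (comb_molecule (leaf_sum n)) `^ p.
Proof.
have f0 : leaf_coordinates n (base (rim)) = 0.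
  by apply/ffunP => i; rewrite !ffunE /= mulr0.
apply: le_trans (powR_le p0 _ (le_free_norm p0 (leaf_sum n) f0
  (@leaf_coordinates_lipschitz n))); last exact: powR_ge0.
have -> : comb (@leaf_coordinates n) (leaf_sum n) = [ffun=> 2 `^ q^-1].
  rewrite comb_leaf_sum; apply/ffunP => i; rewrite sum_ffunE ffunE.
  rewrite (bigD1 i)//= big1 => [|j ji]; rewrite ffunE ?eqxx ?mulr1 ?addr0//.
  case: eqP => [[/val_inj ij]|_]; last by rewrite mulr0.
  by rewrite ij eqxx in ji.
rewrite /pnorm /= split_normE// le_max; apply/orP; left.
rewrite /pos_energy (eq_bigr (fun=> (2 `^ q^-1) `^ p)) => [|i _].
  by rewrite sumr_const card_ord mulr_natl.
by rewrite ffunE max_l// powR_ge0.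
Qed.

End Star.

(** If a > b, the hypothesis reads n^(1-p) <= b / (a - b), which fails for large n
    since p < 1. *)
Lemma sublinear_absorbed (R : realType) (p a b : R) : 0 < p -> p < 1 -> 0 <= b ->
  (forall n : nat, n%:R * a <= b * (n%:R + n%:R `^ p)) -> a <= b.
Proof.
move=> p0 p1 b0 h; rewrite leNgt; apply/negP => ba.
have ab0 : 0 < a - b by rewrite subr_gt0.
have q0 : 0 < 1 - p by rewrite subr_gt0.
pose n := (Num.truncn ((b / (a - b)) `^ (1 - p)^-1)).+1.
have : b / (a - b) < n%:R `^ (1 - p).
  rewrite -[ltLHS](powRVK q0) ?divr_ge0 ?(ltW ab0)//.
  by apply: powR_lt; rewrite ?powR_ge0 ?truncnS_gt.
rewrite ltr_pdivrMr// ltNge => /negP; apply.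
have np0 : 0 < n%:R `^ p :> R by rewrite powR_gt0 ?ltr0n.
rewrite -(ler_pM2r np0) mulrAC -powRD; last by rewrite pnatr_eq0 implybT.
rewrite subrK powRr1// mulrBr lerBlDr; apply: le_trans (h n) _.
by rewrite mulrDr addrC mulrC [n%:R * b]mulrC.
Qed.

Theorem theorem6p1 (R : realType) (p q : R)
    (p0 : 0 < p) (p1 : p < 1) (pq : p <= q) (q1 : q <= 1) :
  exists (M : pointedPMetric q) (N : set M) (N0 : N (base M))
    (L : lipschitz_free p0 (restr N0) -> lipschitz_free p0 M),
    [/\ inclusion_induced L, isomorphic_embedding L, ~ isometric L
      & 2 `^ q^-1 <= op_norm (range L) (range_inv L)].
Proof.
have q0 : 0 < q := lt_le_trans p0 pq.
have c0 : 0 < 2 `^ q^-1 :> R by rewrite powR_gt0.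
pose L : lipschitz_free p0 (rim q0) -> lipschitz_free p0 (star q0) :=
  free_map (h := @inclusion _ _ q0) erefl ltr01 (@inclusion_lipschitz _ _ q0).
have linL : linear L by exact: completion_map_linear.
have LC x : pnorm (L x) <= 1 * pnorm x by exact: completion_map_norm.
have LD x : pnorm x <= 2 `^ q^-1 * pnorm (L x).
  have collapse0 : collapse (base (star q0)) = base (rim q0) by exact: val_inj.
  rewrite -{1}[x](free_mapK erefl collapse0 (@inclusionK _ _ q0) ltr01 c0
    (@inclusion_lipschitz _ _ q0) (@collapse_lipschitz _ _ q0)).
  exact: completion_map_norm.
have constant_ge K : 0 <= K -> (forall x, pnorm x <= K * pnorm (L x)) ->
    2 `^ q^-1 <= K.
  move=> K0 hK; apply: (powR_leV p0) => //.
  apply: (sublinear_absorbed p0 p1) => [|n]; first exact: powR_ge0.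
  apply: le_trans (leaves_norm_ge q0 p0 (ltW p1) n) _.
  apply: le_trans (ler_wpM2l (powR_ge0 _ _) (star_norm_le q0 p0 n)).
  rewrite -powRM// ?free_norm_ge0//; apply: powR_le => //.
    exact: free_norm_ge0.
  have := hK (to_completion p0 (free_seminormP p0 _)
                (comb_molecule (leaf_sum q0 n))).
  by rewrite /L free_map_comb /pnorm /= !to_completion_norm.
have op_ge : 2 `^ q^-1 <= op_norm (range L) (range_inv L).
  exact: constant_ge (op_norm_ge0 _ _) (op_norm_range_inv linL c0 LD).
exists (star q0), (@leaves R q q0), (leaves_Some q0 0), L; split => //.
- split=> //; first by exists 1.
  by move=> x; exact: free_map_delta.
- exact: (bounded_below_embedding linL (@ltr01 R) LC c0 LD).
- move=> isoL; have : 2 `^ q^-1 <= 1 :> R.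
    by apply: constant_ge => // x; rewrite isoL mul1r.
  rewrite leNgt => /negP; apply; apply: (powR_ltV q0) => //.
  by rewrite powRVK// powR1 ltr1n.
Qed.
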